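(* Let $k\ge0$ and $\ell\ge 0$ be fixed integers. For $\omega\in\mathfrak{B}_n$ chosen uniformly at random, with $\alpha=\alpha(\omega)$ and $\beta=\beta(\omega)$, as $n\to\infty$, $$\mathbb{E}\left[\alpha^k\beta^\ell\right]\sim\frac{n^{3(k+\ell)}}{2^{k+\ell-1}(k+\ell+1)\binom{3(k+\ell)+2}{3k+1}(2k+1)\binom{2k}{k}(2\ell+1)\binom{2\ell}{\ell}}.$$
   Context: $\mathfrak{S}_n$ is the set of permutations of $[n]=\{1,\dots,n\}$, in one-line notation. A reduction of $\omega\in\mathfrak{S}_n$ interchanges $\omega(i)$ and $\omega(j)$ for some $i<j$ with $\omega(i)>\omega(j)$. Bruhat order: $\pi\le\sigma$ if $\pi$ is obtained from $\sigma$ by a (possibly empty) sequence of reductions. $\mathfrak{B}_n\subseteq\mathfrak{S}_n$ is the set of bigrassmannian permutations, i.e. those $\omega$ such that both $\omega$ and $\omega^{-1}$ have exactly one descent; equivalently $\omega=1\cdots a\,(b+1)\cdots c\,(a+1)\cdots b\,(c+1)\cdots n$ for some $0\le a<b<c\le n$. For $\omega\in\mathfrak{B}_n$, $\beta(\omega)$ is the number of $\pi\in\mathfrak{B}_n$ with $\pi\le\omega$, and $\alpha(\omega)$ is the number of $\tau\in\mathfrak{B}_n$ with $\omega\le\tau$. $f(n)\sim g(n)$ means $f(n)/g(n)\to1$. *)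

(* Defs.v *)
From HB Require Import structures.
From mathcomp Require Import all_boot all_order all_algebra all_fingroup.
From mathcomp Require Import all_classical all_reals all_analysis.

Set Implicit Arguments.
Unset Strict Implicit.
Unset Printing Implicit Defensive.

Import Order.TTheory GRing.Theory Num.Theory.
Import numFieldNormedType.Exports.

Local Open Scope ring_scope.

(* Positions and values are numbered 0, ..., n-1 instead of 1, ..., n. *)

Section Bigrassmannian.
Context {n : nat}.
Implicit Types w p s : 'S_n.

Definition descents w : {set 'I_n} :=
  [set i : 'I_n | [exists j : 'I_n, (j == i.+1 :> nat) && (w j < w i)%N]].

(* Permutations compose from left to right, so that [(tperm i j * w) x] is
   [w (tperm i j x)]: the values at the positions [i] and [j] are swapped. *)
Definition reduction : rel 'S_n := fun s p =>
  [exists i : 'I_n, exists j : 'I_n,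
     [&& (i < j)%N, (s j < s i)%N & p == (tperm i j * s)%g]].

Definition bruhat_le : rel 'S_n := fun p s => connect reduction s p.

Definition bigrassmannian w : bool :=
  (#|descents w| == 1%N) && (#|descents w^-1%g| == 1%N).

Definition alpha w : nat :=
  #|[set s : 'S_n | bigrassmannian s && bruhat_le w s]|.

Definition beta w : nat :=
  #|[set p : 'S_n | bigrassmannian p && bruhat_le p w]|.

End Bigrassmannian.

Definition bigrass (n : nat) : {set 'S_n} := [set w | bigrassmannian w].

(* Expectation of [X] at a uniformly random element of [A]; the value is 0
   when [A] is empty, which for [bigrass n] happens only when [n < 2]. *)
Definition uniform_expectation (R : realType) (T : finType) (A : {set T})
    (X : T -> R) : R :=
  (\sum_(t in A) X t) / #|A|%:R.

Local Open Scope classical_set_scope.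

Definition asymp_equiv (R : realType) (f g : nat -> R) : Prop :=
  (fun n => f n / g n) @ \oo --> (1 : R).

(* Main.v *)
(* A bigrassmannian permutation of [n] is determined by the block lengths
   (a, x, y, z), with x, y >= 1 and a + x + y + z = n, of
     1 ... a | a+x+1 ... a+x+y | a+1 ... a+x | a+x+y+1 ... n.
   Bruhat order is the pointwise comparison of the rank functions
   r_w(u, v) = #{q < u : w(q) < v}, and with I = a + y, J = a + x the rank
   function of the block permutation is min(u, v, a + (u-I)^+ + (v-J)^+).
   Hence (a, x, y, z) <= (a', x', y', z') iff x <= x', y <= y', a >= a' and
   z >= z', which gives
     2 beta = x y (x + y),   2 alpha = A Z (A + Z),   A = a + 1, Z = z + 1.
   Summing alpha^k beta^l over A + x + y + Z = n + 2 gives the convolution, at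
   n + 2, of the sequences s |-> (s/2)^k sum_(A + Z = s) A^k Z^k for k and l
   (A and Z positive); the case k = l = 0 counts the bigrassmannian permutations.
   Asymptotics are propagated through convolutions by comparing sequences with
   the coefficients of (1 - X)^-p, for which convolution is exact. *)

Require Import Defs.
From HB Require Import structures.
From mathcomp Require Import all_boot all_order all_algebra all_fingroup.
From mathcomp Require Import all_classical all_reals all_analysis.
From mathcomp Require Import zify ring lra.

Set Implicit Arguments.
Unset Strict Implicit.
Unset Printing Implicit Defensive.

Import Order.TTheory GRing.Theory Num.Theory.
Import numFieldNormedType.Exports.

Local Open Scope ring_scope.

(** * Rank functions and Bruhat order *)

Section Rank.
Context {n : nat}.
Implicit Types (w s p : 'S_n) (u v : nat).
Local Open Scope nat_scope.

Definition rk w u v : nat := \sum_(q < n) ((q < u) && (w q < v)).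

Lemma sum_ltn_ord u : u <= n -> \sum_(q < n) (q < u) = u.
Proof.
move=> le_un; rewrite -[RHS]card_ord -sum1_card (big_ord_widen n (fun=> 1)) //.
by rewrite [RHS]big_mkcond.
Qed.

Lemma rk_tperm s (i j : 'I_n) u v : i < j -> s j < s i ->
  rk (tperm i j * s)%g u v =
  rk s u v + ((i < u <= j) && (s j < v <= s i)).
Proof.
move=> lt_ij lt_sji.
have nij : j != i by apply: contraTneq lt_ij => ->; rewrite ltnn.
rewrite /rk (bigD1 i) //= (bigD1 j) //= [in RHS](bigD1 i) //= [in RHS](bigD1 j) //=.
rewrite !permM tpermL tpermR.
under eq_bigr => q /andP[nqi nqj] do rewrite permM tpermD 1?eq_sym //.
lia.
Qed.

Lemma rk_reduction s p : reduction s p ->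
  (forall u v, rk s u v <= rk p u v) /\
  exists u v, [/\ u <= n, v <= n & rk s u v < rk p u v].
Proof.
case/existsP => i /existsP[j /and3P[lt_ij lt_sji /eqP ->]].
split=> [u v|]; first by rewrite rk_tperm // leq_addr.
(* The corner [(j, s i)] of the rectangle on which the rank gains 1. *)
exists (j : nat), (s i : nat); split; [exact: ltnW | exact: ltnW |].
by rewrite rk_tperm // lt_ij lt_sji !leqnn addn1.
Qed.

Lemma rk_inv w u v : rk w^-1%g u v = rk w v u.
Proof.
rewrite /rk (reindex_inj (perm_inj (s := w))).
by apply: eq_bigr => q _; rewrite permK andbC.
Qed.

Lemma rk_full w u v : u <= n -> n <= v -> rk w u v = u.
Proof.
move=> le_un le_nv; rewrite -[RHS]sum_ltn_ord //; apply: eq_bigr => q _.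
by rewrite (leq_trans (ltn_ord (w q)) le_nv) andbT.
Qed.

Lemma bruhat_le_rk p s : bruhat_le p s ->
  forall u v, rk s u v <= rk p u v.
Proof.
case/connectP => c; elim: c s => [|x c IHc] s /=; first by move=> _ -> u v.
case/andP=> /rk_reduction[lesx _] px pE u v.
by apply: leq_trans (lesx u v) _; apply: IHc.
Qed.

(* At the first position [i] where they differ, [p i < s i]; swap [s i] with
   the first later value of [s] in [[p i, s i)]. *)
Lemma rk_step s p : (forall u v, u <= n -> v <= n -> rk s u v <= rk p u v) ->
  s != p -> exists2 s', reduction s s' &
    forall u v, u <= n -> v <= n -> rk s' u v <= rk p u v.
Proof.
move=> lesp nsp.
have [i0 ni0] : exists i : 'I_n, s i != p i.
  by apply/existsP; apply: contraR nsp => /existsPn eqsp; apply/eqP/permP => x;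
     apply/eqP; move: (eqsp x); rewrite negbK.
have [i nspi mini] := @arg_minnP _ i0 (fun i => s i != p i) (@nat_of_ord n) ni0.
have eqsp (q : 'I_n) : q < i -> s q = p q.
  by move=> ltqi; apply/eqP; apply: contraLR ltqi => /mini; rewrite -leqNgt.
(* If [s i < p i], the ranks at [(i + 1, s i + 1)] would violate the hypothesis, since [s] and [p]
   agree before [i]. *)
have lt_ps : p i < s i.
  have := lesp i.+1 (s i).+1 (ltn_ord i) (ltn_ord (s i)).
  rewrite ltnNge; apply: contraL => le_sp.
  have lt_sp : s i < p i by rewrite ltn_neqAle le_sp andbT.
  rewrite -ltnNge /rk (bigD1 i) //= [X in _ < X](bigD1 i) //= !ltnS !leqnn.
  rewrite [p i <= s i]leqNgt lt_sp /= add0n add1n ltnS; apply: leq_sum => q nqi.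
  case: (ltngtP q i) => [lt_qi|lt_iq|/val_inj eq_qi].
  - by rewrite (eqsp q).
  - by rewrite [q < i.+1]ltnS [q <= i]leqNgt lt_iq.
  - by rewrite eq_qi eqxx in nqi.
pose P (j : 'I_n) := (i < j) && (p i <= s j < s i).
have Pj0 : P (s^-1%g (p i)).
  rewrite /P permKV leqnn lt_ps !andbT ltnNge leq_eqVlt negb_or; apply/andP; split.
    by apply: contra nspi => /eqP/val_inj eqi; rewrite -{1}eqi permKV.
  apply/negP => lti; have := eqsp _ lti; rewrite permKV => /perm_inj eqi.
  by rewrite -eqi ltnn in lti.
have [j /andP[lt_ij /andP[le_pj lt_ji]] minj] := @arg_minnP _ _ P (@nat_of_ord n) Pj0.
exists (tperm i j * s)%g.
  by apply/existsP; exists i; apply/existsP; exists j; rewrite lt_ij lt_ji eqxx.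
move=> u v le_un le_vn.
rewrite rk_tperm //.
case: (boolP (_ && _)) => [|_]; last by rewrite addn0 lesp.
case/andP=> /andP[lt_iu le_uj] /andP[lt_jv le_vi].
(* Values below [p i] are covered by the hypothesis. For values in [[p i, v)], minimality of [j]
   rules out positions of [s] between [i] and [u], while [p] has position [i] itself, which pays for
   the gain of 1. *)
have splitE w : rk w u v = rk w u (p i) + \sum_(q < n) ((q < u) && (p i <= w q < v)).
  by rewrite /rk -big_split; apply: eq_bigr => q _ /=; lia.
rewrite (splitE s) (splitE p) -addnA leq_add //; first by apply: lesp => //; lia.
have -> : true = 1 :> nat by [].
rewrite (bigD1 i) //= [X in _ <= X](bigD1 i) //= lt_iu leqnn /=.
have -> : (s i < v) = false by lia.
have -> : p i < v by lia.
rewrite andbF add0n addn1 add1n ltnS; apply: leq_sum => q nqi.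
case: (ltngtP q i) => [lt_qi|lt_iq|/val_inj eq_qi].
- by rewrite (eqsp q).
- case: (boolP (_ && _)) => // /andP[lt_qu /andP[le_pq lt_qv]].
  suff /minj : P q by lia.
  by rewrite /P lt_iq le_pq; lia.
- by rewrite eq_qi eqxx in nqi.
Qed.

(** Iterating [rk_step] terminates: the total rank [mu] strictly increases with each reduction and
    never exceeds [mu p]. *)
Lemma rk_bruhat_le p s :
  (forall u v, u <= n -> v <= n -> rk s u v <= rk p u v) -> bruhat_le p s.
Proof.
pose mu w := \sum_(u < n.+1) \sum_(v < n.+1) rk w u v.
have [m] := ubnP (mu p - mu s); elim: m s => // m IHm s lt_m lesp.
have [->|nsp] := eqVneq s p; first exact: connect0.
have [s' ss' lesp'] := rk_step lesp nsp.
apply: connect_trans (connect1 ss') _; apply: IHm => //.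
have [ler [u0 [v0 [leu lev ltr]]]] := rk_reduction ss'.
have lt_mu : mu s < mu s'.
  rewrite /mu (bigD1 (Ordinal (leu : u0 < n.+1))) //=.
  rewrite (bigD1 (Ordinal (lev : v0 < n.+1))) //=.
  rewrite [X in _ < X](bigD1 (Ordinal (leu : u0 < n.+1))) //=.
  rewrite [X in _ < X + _](bigD1 (Ordinal (lev : v0 < n.+1))) //=.
  rewrite -addSn leq_add //; last by apply: leq_sum => u _; apply: leq_sum.
  by rewrite -addSn leq_add //; apply: leq_sum.
have le_mu : mu s' <= mu p.
  by apply: leq_sum => u _; apply: leq_sum => v _; apply: lesp'; rewrite -ltnS.
lia.
Qed.

(** If [s] and [p] differed, [rk_step] would give a reduction of [s] whose rank stays below that of
    [p], but a reduction raises some rank strictly. *)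
Lemma rk_inj s p :
  (forall u v, u <= n -> v <= n -> rk s u v = rk p u v) -> s = p.
Proof.
move=> eqsp; apply/eqP; apply: contraT => nsp.
have lesp u v : u <= n -> v <= n -> rk s u v <= rk p u v.
  by move=> leu lev; rewrite eqsp.
have [s' /rk_reduction[_ [u [v [leu lev lt_rk]]]] les'p] := rk_step lesp nsp.
by have := les'p u v leu lev; rewrite -eqsp // leqNgt lt_rk.
Qed.

(* [u |-> rk w u v] has slope 1, then slope 0, on an interval where [w]
   increases. *)
Lemma rk_interval w I K u v :
  (forall q q' : 'I_n, I <= q < q' -> q' < K -> w q < w q') ->
  I <= u <= K -> K <= n ->
  rk w u v = minn (rk w I v + (u - I)) (rk w K v).
Proof.
move=> incr /andP[leIu leuK] leKn.
have leK : rk w u v <= rk w K v by apply: leq_sum => q _; lia.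
have leI : rk w u v + I <= rk w I v + u.
  rewrite -[X in _ + X <= _]sum_ltn_ord; last lia.
  rewrite -[X in _ <= _ + X]sum_ltn_ord; last lia.
  by rewrite -!big_split; apply: leq_sum => q _ /=; lia.
(* Once a value reaches [v], all later positions up to [K] do too, and the rank is already
   [rk w K v]; otherwise every position in [[I, u)] is counted. *)
case: (boolP [exists q : 'I_n, (I <= q < u) && (v <= w q)]).
  case/existsP => q0 /andP[/andP[leq0 ltq0] levq0].
  have : rk w K v <= rk w u v; last by lia.
  apply: leq_sum => q _; case: (leqP u q) => [leuq|]; last lia.
  by case: (ltnP q K) => [/(incr q0)|//]; lia.
move/existsPn => small.
have : rk w I v + u <= rk w u v + I; last by lia.
rewrite -[X in _ <= _ + X]sum_ltn_ord; last lia.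
rewrite -[X in _ + X <= _]sum_ltn_ord; last lia.
rewrite -!big_split; apply: leq_sum => q _ /=.
by have := small q; lia.
Qed.

(** Interpolating in [u] for [w], then in [v] for its inverse through [rk_inv], reduces the whole
    rank table to its value at [(I, J)]. *)
Lemma rk_grassmannian_pair w I J u v :
  (forall q q' : 'I_n, q < q' -> (q' < I) || (I <= q) -> w q < w q') ->
  (forall q q' : 'I_n, q < q' -> (q' < J) || (J <= q) -> w^-1%g q < w^-1%g q') ->
  I <= n -> J <= n -> u <= n -> v <= n ->
  rk w u v = minn (minn u v) (rk w I J + (u - I) + (v - J)).
Proof.
move=> incw incw' leI leJ leu lev.
have rk0 p x : rk p 0 x = 0 by rewrite /rk big1.
have half p K x y : K <= n -> x <= n -> y <= n ->
    (forall q q' : 'I_n, q < q' -> (q' < K) || (K <= q) -> p q < p q') ->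
    rk p x y = minn (minn x y) (rk p K y + (x - K)).
  move=> leK lex ley inc; case: (leqP x K) => [lexK|/ltnW leKx].
    rewrite (@rk_interval p 0 K x y) //.
    - have : rk p K y <= y.
        by rewrite -[X in _ <= X](@rk_full p^-1%g y n) // rk_inv leq_sum // => q _; lia.
      rewrite rk0 //; lia.
    - by move=> q q' /andP[_ lt] lt'; apply: inc; rewrite ?lt'.
  rewrite (@rk_interval p K n x y) //.
  - have -> : rk p n y = y by rewrite -rk_inv rk_full.
    have : rk p K y <= K.
      by rewrite -[X in _ <= X](@rk_full p K n) // leq_sum // => q _; lia.
    lia.
  - by move=> q q' /andP[le lt] lt'; apply: inc; rewrite ?le ?orbT.
  - by rewrite leKx.
rewrite (half w I) // -[rk w I v]rk_inv (half _ J) // rk_inv.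
lia.
Qed.

End Rank.
(** * Bigrassmannian permutations as block permutations *)

Section Blocks.
Context {n : nat}.
Implicit Types (w s p : 'S_n) (u v : nat).
Local Open Scope nat_scope.

(* The paper's [1 ... a (b+1) ... c (a+1) ... b (c+1) ... n] with [b = a + x]
   and [c = a + x + y]; the identity when [c > n]. *)
Definition block_nat (a x y q : nat) : nat :=
  if a + x + y <= n then
    if q < a then q else if q < a + y then q + x
    else if q < a + x + y then q - y else q
  else q.

Lemma block_nat_lt a x y (q : 'I_n) : block_nat a x y q < n.
Proof. by have := ltn_ord q; rewrite /block_nat; do !case: ifP => //; lia. Qed.

Definition block_ord a x y (q : 'I_n) : 'I_n := Ordinal (block_nat_lt a x y q).

Lemma block_ordK a x y : cancel (block_ord a x y) (block_ord a y x).
Proof. by move=> q; apply: val_inj; rewrite /= /block_nat; do !case: ifP => //; lia. Qed.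

Definition block_perm a x y : 'S_n := perm (can_inj (block_ordK a x y)).

Lemma block_permE a x y (q : 'I_n) :
  block_perm a x y q = block_nat a x y q :> nat.
Proof. by rewrite permE. Qed.

Lemma block_permV a x y : (block_perm a x y)^-1%g = block_perm a y x.
Proof.
apply/permP => q; apply: (@perm_inj _ (block_perm a x y)); rewrite permKV.
by rewrite !permE block_ordK.
Qed.

Lemma block_descents a x y : 0 < x -> 0 < y -> a + x + y <= n ->
  #|descents (block_perm a x y)| == 1.
Proof.
move=> x_gt0 y_gt0 le_n; have lt_n : (a + y).-1 < n by lia.
apply/cards1P; exists (Ordinal lt_n); apply/setP => i; rewrite !inE -val_eqE /=.
apply/existsP/eqP => [[j /andP[/eqP eqj]] | eqi].
  by rewrite !block_permE eqj /block_nat le_n; do !case: ifP; lia.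
have lt_i : i.+1 < n by lia.
exists (Ordinal lt_i); rewrite eqxx !block_permE /= eqi /block_nat le_n.
by do !case: ifP; lia.
Qed.

Lemma block_bigrassmannian a x y : 0 < x -> 0 < y -> a + x + y <= n ->
  bigrassmannian (block_perm a x y).
Proof.
move=> x_gt0 y_gt0 le_n.
by rewrite /bigrassmannian block_permV !block_descents //; lia.
Qed.

Lemma block_perm_incr a x y (q q' : 'I_n) :
  q < q' -> (q' < a + y) || (a + y <= q) ->
  block_perm a x y q < block_perm a x y q'.
Proof.
by move=> lt_qq'; rewrite !block_permE /block_nat; do !case: ifP; lia.
Qed.

Lemma rk_block a x y u v : a + x + y <= n -> u <= n -> v <= n ->
  rk (block_perm a x y) u v =
  minn (minn u v) (a + (u - (a + y)) + (v - (a + x))).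
Proof.
move=> le_n leu lev.
rewrite (@rk_grassmannian_pair _ _ (a + y) (a + x)) //; first last.
- lia.
- lia.
- by rewrite block_permV; apply: block_perm_incr.
- exact: block_perm_incr.
suff -> : rk (block_perm a x y) (a + y) (a + x) = a by [].
rewrite -[RHS](@sum_ltn_ord n); last lia.
apply: eq_bigr => q _; rewrite block_permE /block_nat le_n.
by do !case: ifP; lia.
Qed.

Lemma block_bruhat_le a x y a' x' y' :
  0 < x -> 0 < y -> a + x + y <= n -> a' + x' + y' <= n ->
  bruhat_le (block_perm a x y) (block_perm a' x' y') =
  [&& x <= x', y <= y', a' <= a & a + x + y <= a' + x' + y'].
Proof.
move=> x_gt0 y_gt0 le_n le_n'; apply/idP/idP => [/bruhat_le_rk h | h].
  (* The corner [(a + y, a + x)] alone yields all four inequalities: the rank of the smaller element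
     there is [a], and positivity of [x] and [y] forces the third term of the other minimum to be at
     most [a]. *)
  have := h (a + y) (a + x); rewrite !rk_block //; lia.
apply: rk_bruhat_le => u v leu lev; rewrite !rk_block //; lia.
Qed.

(** Equal permutations are comparable both ways, and the comparison of parameters is
    antisymmetric. *)
Lemma block_perm_inj a x y a' x' y' : 0 < x -> 0 < y -> 0 < x' -> 0 < y' ->
  a + x + y <= n -> a' + x' + y' <= n ->
  block_perm a x y = block_perm a' x' y' -> [/\ a = a', x = x' & y = y'].
Proof.
move=> x0 y0 x0' y0' le_n le_n' eqp.
have : bruhat_le (block_perm a x y) (block_perm a' x' y').
  by rewrite eqp; apply: connect0.
have : bruhat_le (block_perm a' x' y') (block_perm a x y).
  by rewrite eqp; apply: connect0.
by rewrite !block_bruhat_le // => h h'; split; lia.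
Qed.

Lemma increasing_off_descents w (d q q' : 'I_n) : descents w = [set d] ->
  q < q' -> (q' < d.+1) || (d.+1 <= q) -> w q < w q'.
Proof.
move=> desw; have [k eqq'] : exists k, q' = k :> nat by exists q'.
elim: k q' eqq' => [|k IHk] q' eqq' lt_qq' Hd; first by lia.
have lt_k : k < n by have := ltn_ord q'; lia.
have step : w (Ordinal lt_k) < w q'.
  rewrite ltnNge; apply/negP => le_w.
  have : Ordinal lt_k \in descents w.
    rewrite inE; apply/existsP; exists q'; rewrite /= eqq' eqxx /=.
    rewrite ltn_neqAle le_w andbT; apply/eqP => /val_inj/perm_inj eqk.
    by have := congr1 val eqk; rewrite /=; lia.
  by rewrite desw inE -val_eqE /=; lia.
have [eqqk|neqk] := eqVneq (q : nat) k.
  by suff -> : q = Ordinal lt_k by []; apply: val_inj.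
by apply: ltn_trans step; apply: IHk => //=; lia.
Qed.

Lemma descents_lt w d : d \in descents w -> d.+1 < n.
Proof. by rewrite inE => /existsP[j /andP[/eqP <- _]]. Qed.

(** The two descents and the rank [a] at the corner they define determine the rank function, which
    is that of a block permutation; [rk_inj] concludes. *)
Lemma bigrassmannian_block w : bigrassmannian w ->
  exists a x y, [/\ 0 < x, 0 < y, a + x + y <= n & w = block_perm a x y].
Proof.
case/andP=> /cards1P[d desw] /cards1P[d' desw'].
have lt_d : d.+1 < n by apply: (@descents_lt w); rewrite desw set11.
have lt_d' : d'.+1 < n by apply: (@descents_lt w^-1%g); rewrite desw' set11.
pose a := rk w d.+1 d'.+1.
have rkw u v : u <= n -> v <= n ->
    rk w u v = minn (minn u v) (a + (u - d.+1) + (v - d'.+1)).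
  move=> leu lev; apply: rk_grassmannian_pair => //; try exact: ltnW.
  - by move=> q q'; apply: increasing_off_descents.
  - by move=> q q'; apply: increasing_off_descents.
have le_a : a <= d.+1 /\ a <= d'.+1.
  by have := rkw d.+1 d'.+1; rewrite -/a; lia.
have ge_a : d.+1 + d'.+1 <= a + n.
  by have := rkw n d'.+1; rewrite -rk_inv rk_full; lia.
(* Otherwise the rank function would be [minn u v], that of the identity, which has no descent. *)
have neq_a : (a != d.+1) && (a != d'.+1).
  rewrite -negb_or; apply/negP => eq_a.
  have w1 : w = block_perm 0 0 0.
    by apply: rk_inj => u v leu lev; rewrite rkw // rk_block //; lia.
  have : d \in descents w by rewrite desw set11.
  rewrite w1 inE => /existsP[j]; rewrite !block_permE /block_nat leq0n /=.
  by lia.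
exists a, (d'.+1 - a), (d.+1 - a); split; [lia|lia|lia|].
apply: rk_inj => u v leu lev; rewrite rkw // rk_block //; lia.
Qed.

End Blocks.
(** * Counting *)

Section Counting.
Local Open Scope nat_scope.

(** Common parameter set for the elements below and above a block permutation. The range [p + q]
    exceeds every [u + v], so no admissible third coordinate is lost. *)
Definition box_staircase p q : {set 'I_p * 'I_q * 'I_(p + q)} :=
  [set t : 'I_p * 'I_q * 'I_(p + q) | t.2 <= t.1.1 + t.1.2].

Lemma card_box_staircase p q : (#|box_staircase p q|).*2 = p * q * (p + q).
Proof.
have -> : #|box_staircase p q| = \sum_(u < p) \sum_(v < q) (u + v).+1.
  rewrite pair_bigA /= -sum1_card big_mkcond /=.
  transitivity (\sum_uv \sum_(w < p + q) (((uv, w) \in box_staircase p q) : nat)).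
    by rewrite pair_bigA; apply: eq_bigr => -[uv w] _ /=; case: ifP.
  apply: eq_bigr => -[u v] _ /=.
  rewrite -[RHS](@sum_ltn_ord (p + q)); last by have := ltn_ord u; have := ltn_ord v; lia.
  by apply: eq_bigr => w _; rewrite inE /=; lia.
have inner c : (\sum_(v < q) (c + v).+1).*2 = q * (c.*2 + q.+1).
  elim: q => [|q IHq]; first by rewrite big_ord0.
  by rewrite big_ord_recr /= doubleD IHq; nia.
elim: p => [|p IHp]; first by rewrite big_ord0.
by rewrite big_ord_recr /= doubleD IHp inner; nia.
Qed.

Lemma double_beta_block n a x y : 0 < x -> 0 < y -> a + x + y <= n ->
  (beta (block_perm a x y : 'S_n)).*2 = x * y * (x + y).
Proof.
move=> x_gt0 y_gt0 le_n; rewrite -card_box_staircase /beta.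
(* [u] and [v] shorten the two blocks and [w] moves their start right; the end stays within
   [a + x + y] exactly when [w <= u + v]. *)
pose f (t : 'I_x * 'I_y * 'I_(x + y)) : 'S_n :=
  block_perm (a + t.2) (x - t.1.1) (y - t.1.2).
rewrite -(@card_in_imset _ _ f (box_staircase x y)); last first.
  move=> [[u v] w] [[u' v'] w']; rewrite !inE /f /= => le_w le_w'.
  have := (ltn_ord u, ltn_ord v, ltn_ord u', ltn_ord v').
  move=> [[[lt_u lt_v] lt_u'] lt_v'].
  case/block_perm_inj; [lia|lia|lia|lia|lia|lia|] => eqa eqx eqy.
  by congr (_, _, _); apply: val_inj => /=; lia.
congr (#|pred_of_set _|.*2); apply/setP => p; rewrite inE.
apply/andP/imsetP => [[/bigrassmannian_block[a' [x' [y' [x0 y0 le_n' ->]]]]] | ].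
  rewrite block_bruhat_le // => /and4P[lex ley lea len].
  have lt_u : x - x' < x by lia.
  have lt_v : y - y' < y by lia.
  have lt_w : a' - a < x + y by lia.
  exists (Ordinal lt_u, Ordinal lt_v, Ordinal lt_w); first by rewrite inE /=; lia.
  by rewrite /f /= !subKn // subnKC.
move=> [[[u v] w]]; rewrite inE /f /= => le_w ->.
have := (ltn_ord u, ltn_ord v) => -[lt_u lt_v].
by split; [apply: block_bigrassmannian | rewrite block_bruhat_le]; lia.
Qed.

Lemma double_alpha_block n a x y : 0 < x -> 0 < y -> a + x + y <= n ->
  (alpha (block_perm a x y : 'S_n)).*2 =
  a.+1 * (n - (a + x + y)).+1 * (a.+1 + (n - (a + x + y)).+1).
Proof.
move=> x_gt0 y_gt0 le_n; set z := n - _; rewrite -card_box_staircase /alpha.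
(* [u] moves the start left and [v] the end right; of the [u + v] new places, [w] go to the first
   length and the rest to the second. *)
pose f (t : 'I_a.+1 * 'I_z.+1 * 'I_(a.+1 + z.+1)) : 'S_n :=
  block_perm (a - t.1.1) (x + t.2) (y + (t.1.1 + t.1.2 - t.2)).
rewrite -(@card_in_imset _ _ f (box_staircase a.+1 z.+1)); last first.
  move=> [[u v] w] [[u' v'] w']; rewrite !inE /f /= => le_w le_w'.
  have := (ltn_ord u, ltn_ord v, ltn_ord u', ltn_ord v').
  move=> [[[lt_u lt_v] lt_u'] lt_v'].
  case/block_perm_inj; [lia|lia|lia|lia|lia|lia|] => eqa eqx eqy.
  by congr (_, _, _); apply: val_inj => /=; lia.
congr (#|pred_of_set _|.*2); apply/setP => p; rewrite inE.
apply/andP/imsetP => [[/bigrassmannian_block[a' [x' [y' [x0 y0 le_n' ->]]]]] | ].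
  rewrite block_bruhat_le // => /and4P[lex ley lea len].
  have lt_u : a - a' < a.+1 by lia.
  have lt_v : a' + x' + y' - (a + x + y) < z.+1 by lia.
  have lt_w : x' - x < a.+1 + z.+1 by lia.
  exists (Ordinal lt_u, Ordinal lt_v, Ordinal lt_w); first by rewrite inE /=; lia.
  by rewrite /f /=; congr block_perm; lia.
move=> [[[u v] w]]; rewrite inE /f /= => le_w ->.
have := (ltn_ord u, ltn_ord v) => -[lt_u lt_v].
by split; [apply: block_bigrassmannian | rewrite block_bruhat_le]; lia.
Qed.

End Counting.

(** * Moment sums as convolutions *)

Definition conv (R : pzSemiRingType) (f g : nat -> R) (N : nat) : R :=
  \sum_(i < N.+1) f i * g (N - i)%N.

(* The factor [0 < i] matters only for [k = 0], where [0 ^+ 0 = 1]. *)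
Definition pos_pow (R : pzSemiRingType) (k i : nat) : R :=
  (0 < i)%N%:R * i%:R ^+ k.

(* Sum of [(A Z (A + Z) / 2) ^ k] over positive [A, Z] with [A + Z = s]. *)
Definition moment (R : numFieldType) (k s : nat) : R :=
  (s%:R / 2) ^+ k * conv (pos_pow R k) (pos_pow R k) s.

(** Past [N], truncated subtraction turns the second factor into [g 0]. A common index range lets
    the inner sums of [sum_bigrass] merge. *)
Lemma conv_widen (R : pzSemiRingType) (f g : nat -> R) (N M : nat) :
  g 0%N = 0 -> (N <= M)%N -> conv f g N = \sum_(i < M.+1) f i * g (N - i)%N.
Proof.
move=> g0 leNM; rewrite /conv (big_ord_widen M.+1 (fun i => f i * g (N - i)%N)) //.
rewrite big_mkcond; apply: eq_bigr => i _; case: ltnP => // ltNi.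
have -> : (N - i = 0)%N by lia.
by rewrite g0 mulr0.
Qed.

Lemma pos_pow0 (R : pzSemiRingType) k : pos_pow R k 0%N = 0.
Proof. by rewrite /pos_pow mul0r. Qed.

(* Reindexes by [s = A + Z], [A = a + 1] and [x], so that [y = n + 2 - s - x]. *)
Lemma sum_bigrass (R : numFieldType) (k l n : nat) :
  \sum_(w in bigrass n) ((alpha w)%:R ^+ k * (beta w)%:R ^+ l : R) =
  conv (moment R k) (moment R l) n.+2.
Proof.
pose I3 := ('I_n.+3 * ('I_n.+3 * 'I_n.+3))%type.
pose D : {set I3} := [set t : I3 |
  [&& 0 < t.2.1, t.2.1 < t.1, 0 < t.2.2 & t.1 + t.2.2 < n.+2]%N].
pose f (t : I3) : 'S_n := block_perm t.2.1.-1 t.2.2 (n.+2 - t.1 - t.2.2).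
have -> : bigrass n = f @: D.
  apply/setP => w; rewrite inE; apply/idP/imsetP.
    case/bigrassmannian_block => [a [x [y [x0 y0 le_n ->]]]].
    have lt_s : (n.+2 - (x + y) < n.+3)%N by lia.
    have lt_A : (a.+1 < n.+3)%N by lia.
    have lt_x : (x < n.+3)%N by lia.
    exists (Ordinal lt_s, (Ordinal lt_A, Ordinal lt_x)); first by rewrite inE /=; lia.
    by rewrite /f /=; congr block_perm; lia.
  move=> [[s [A x]]]; rewrite inE /f /= => lt_t ->.
  by apply: block_bigrassmannian; lia.
rewrite big_imset /=; last first.
  move=> [s [A x]] [s' [A' x']]; rewrite !inE /f /= => lt_t lt_t'.
  case/block_perm_inj; [lia|lia|lia|lia|lia|lia|] => eqa eqx eqy.
  by congr (_, (_, _)); apply: val_inj => /=; lia.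
pose F (t : I3) : R := if t \in D then
  (alpha (f t))%:R ^+ k * (beta (f t))%:R ^+ l else 0.
rewrite big_mkcond (_ : \sum_t _ = \sum_s \sum_t F (s, t)); last first.
  by rewrite pair_bigA; apply: eq_bigr => -[].
rewrite /conv; apply: eq_bigr => s _.
rewrite /moment !(@conv_widen _ _ _ _ n.+2) ?pos_pow0 ?leq_subr //; last first.
  by rewrite -ltnS.
rewrite mulrACA big_distrlr /= pair_bigA mulr_sumr; apply: eq_bigr => -[A x] _ /=.
rewrite /F; case: ifP => [inD | notD].
  move: inD; rewrite inE /= => /and4P[A0 ltAs x0 ltx].
  have le_n : (A.-1 + x + (n.+2 - s - x) <= n)%N by lia.
  have y0 : (0 < n.+2 - s - x)%N by lia.
  have half (p q : nat) : p.*2 = q -> p%:R = q%:R / 2 :> R.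
    by move=> <-; rewrite -muln2 natrM mulfK // pnatr_eq0.
  rewrite (half _ _ (double_alpha_block x0 y0 le_n)).
  rewrite (half _ _ (double_beta_block x0 y0 le_n)) /pos_pow.
  rewrite (_ : A.-1.+1 = A); last lia.
  rewrite (_ : (n - (A.-1 + x + (n.+2 - s - x))).+1 = s - A)%N; last lia.
  rewrite (_ : A + (s - A) = s)%N; last lia.
  rewrite (_ : x + (n.+2 - s - x) = n.+2 - s)%N; last lia.
  rewrite A0 x0 y0 subn_gt0 ltAs !mul1r !natrM !exprMn.
  have swap (a b c d e f' g h : R) :
    a * b * c * d * (e * f' * g * h) = c * d * (g * h) * (a * b * (e * f')) by ring.
  exact: swap.
move: notD; rewrite inE /= => notD.
(* Outside [D] one of [A], [x], [s - A], [n + 2 - s - x] is 0 after truncation, so a [pos_pow]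
   factor vanishes, even for exponent 0. *)
have [A0|] := posnP A; first by rewrite A0 pos_pow0 !(mul0r, mulr0).
have [x0|] := posnP x; first by rewrite x0 pos_pow0 !(mul0r, mulr0).
move=> x_gt0 A_gt0; have [leAs|leyx] : (s - A = 0 \/ n.+2 - s - x = 0)%N by lia.
  by rewrite leAs pos_pow0 !(mul0r, mulr0).
by rewrite leyx pos_pow0 !(mul0r, mulr0).
Qed.
(** * Asymptotics of convolutions *)

Section ConvolutionAsymptotics.
Context {R : realFieldType}.
Implicit Types (f g : nat -> R) (p q n : nat).

(* The coefficient of [X^n] in [(1 - X)^-p]; truncated predecessor makes the
   formula correct for [p = 0] too. *)
Definition negbin p n : R := 'C((n + p).-1, n)%:R.

Lemma negbin_ge0 p n : 0 <= negbin p n.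
Proof. exact: ler0n. Qed.

Lemma negbin_n0 p : negbin p 0 = 1.
Proof. by rewrite /negbin bin0. Qed.

Lemma negbinSS p n : negbin p.+1 n.+1 = negbin p.+1 n + negbin p n.+1.
Proof. by rewrite /negbin !addSn !addnS /= binS natrD addrC. Qed.

Lemma negbin_leS p n : negbin p n <= negbin p.+1 n.
Proof.
case: n => [|n]; first by rewrite !negbin_n0.
by rewrite negbinSS lerDr negbin_ge0.
Qed.

(** Coefficientwise, [X d/dX] maps [(1 - X)^-p] to [p ((1 - X)^-(p+1) - (1 - X)^-p)]. *)
Lemma mulr_negbin p n :
  n%:R * negbin p n = p%:R * (negbin p.+1 n - negbin p n).
Proof.
rewrite mulrBr; apply/eqP; rewrite -subr_eq opprK /negbin -mulrDl -natrD addnS.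
by rewrite -!natrM mul_bin_down addKn.
Qed.

(** Multiplication of power series: by [negbinSS], raising [p] by one takes partial sums on both
    sides. *)
Lemma conv_negbin p q n : conv (negbin p) (negbin q) n = negbin (p + q) n.
Proof.
elim: p n => [|p IHp] n.
  rewrite /conv big_ord_recl negbin_n0 mul1r subn0 big1 ?addr0 // => i _.
  by rewrite /negbin addn0 bin_small ?mul0r.
elim: n => [|n IHn]; first by rewrite /conv big_ord1 !negbin_n0 mul1r.
rewrite addSn negbinSS -addSn -IHn -IHp /conv big_ord_recl.
rewrite [X in _ = _ + X]big_ord_recl /= !negbin_n0 addrCA; congr (_ + _).
rewrite -big_split; apply: eq_bigr => i _.
by rewrite /= /bump add1n subSS negbinSS mulrDl.
Qed.

(* [f n = c n^p / p! + O(n^(p-1))]; when [p = 0] the error is supported at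
   [n = 0]. *)
Definition asy p (c : R) f : Prop :=
  exists K, forall n, `|f n - c * negbin p.+1 n| <= K * negbin p n.

Lemma asy_ext p c f g : asy p c f -> f =1 g -> asy p c g.
Proof. by move=> [K fK] eqfg; exists K => n; rewrite -eqfg. Qed.

Lemma asyZ p c f a : asy p c f -> asy p (a * c) (fun n => a * f n).
Proof.
move=> [K fK]; exists (`|a| * K) => n.
by rewrite -mulrA -mulrBr normrM -mulrA ler_wpM2l.
Qed.

(** By [mulr_negbin], multiplying the main term by [n] gives the next main term plus a multiple of
    [negbin p.+1], which joins the error. *)
Lemma asy_mulX p c f : asy p c f ->
  asy p.+1 (c * p.+1%:R) (fun n => n%:R * f n).
Proof.
move=> [K fK]; exists (K * p%:R + `|c * p.+1%:R|) => n.
have -> : n%:R * f n - c * p.+1%:R * negbin p.+2 n =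
    n%:R * (f n - c * negbin p.+1 n) - c * p.+1%:R * negbin p.+1 n.
  by rewrite mulrBr mulrCA mulr_negbin; ring.
apply: le_trans (ler_normB _ _) _; rewrite mulrDl lerD //; last first.
  by rewrite normrM (ger0_norm (negbin_ge0 _ _)).
rewrite normrM normr_nat; apply: (@le_trans _ _ (n%:R * (K * negbin p n))).
  by rewrite ler_wpM2l.
(* The bound at [n = 0], where [negbin p 0 = 1], forces [K] to be nonnegative. *)
have K_ge0 : 0 <= K.
  by have := le_trans (normr_ge0 _) (fK 0%N); rewrite negbin_n0 mulr1.
rewrite mulrCA mulr_negbin -mulrA ler_wpM2l // ler_wpM2l //.
by rewrite gerBl negbin_ge0.
Qed.

Lemma asy_mulXn p c f k : asy p c f ->
  asy (p + k) (c * (p + k)`!%:R / p`!%:R) (fun n => n%:R ^+ k * f n).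
Proof.
move=> asyf; elim: k => [|k IHk].
  rewrite addn0 mulfK ?pnatr_eq0 -?lt0n ?fact_gt0 //.
  by apply: (asy_ext asyf) => n; rewrite mul1r.
have H := asy_mulX IHk.
have -> : c * (p + k.+1)`!%:R / p`!%:R = c * (p + k)`!%:R / p`!%:R * (p + k).+1%:R.
  by rewrite addnS factS natrM; ring.
by rewrite addnS; apply: (asy_ext H) => n; rewrite exprS mulrA.
Qed.

(** Split each sequence into main term and error. The main terms convolve exactly; the mixed
    products have the allowed error order, and the product of the errors is one order smaller. *)
Lemma asy_conv p q c d f g : asy p c f -> asy q d g ->
  asy (p + q).+1 (c * d) (conv f g).
Proof.
move=> [K fK] [L gL].
have K_ge0 : 0 <= K.
  by have := le_trans (normr_ge0 _) (fK 0%N); rewrite negbin_n0 mulr1.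
have L_ge0 : 0 <= L.
  by have := le_trans (normr_ge0 _) (gL 0%N); rewrite negbin_n0 mulr1.
exists (`|c| * L + K * `|d| + K * L) => n.
have -> : conv f g n - c * d * negbin (p + q).+2 n = \sum_(i < n.+1)
   (f i * g (n - i)%N - c * negbin p.+1 i * (d * negbin q.+1 (n - i))).
  rewrite sumrB; congr (_ - _); rewrite -addnS -addSn -conv_negbin mulr_sumr.
  by apply: eq_bigr => i _; ring.
apply: le_trans (ler_norm_sum _ _ _) _.
apply: (@le_trans _ _ (`|c| * L * conv (negbin p.+1) (negbin q) n +
   K * `|d| * conv (negbin p) (negbin q.+1) n +
   K * L * conv (negbin p) (negbin q) n)); last first.
  rewrite !conv_negbin addSn addnS -mulrDl [leRHS]mulrDl lerD2l.
  by rewrite ler_wpM2l ?mulr_ge0 ?negbin_leS.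
rewrite /conv !mulr_sumr -!big_split; apply: ler_sum => i _ /=.
have := fK i; have := gL (n - i)%N.
set u := f i - _; set v := g _ - _ => v_le u_le.
have -> : f i * g (n - i)%N - c * negbin p.+1 i * (d * negbin q.+1 (n - i)) =
    c * negbin p.+1 i * v + u * (d * negbin q.+1 (n - i)) + u * v.
  by rewrite /u /v; ring.
apply: le_trans (ler_normD _ _) _; apply: lerD; last first.
  by rewrite normrM mulrACA ler_pM.
apply: le_trans (ler_normD _ _) _; apply: lerD.
  by rewrite !normrM (ger0_norm (negbin_ge0 _ _)) mulrACA ler_wpM2l ?mulr_ge0 ?negbin_ge0.
rewrite !normrM (ger0_norm (negbin_ge0 _ _)) [leRHS]mulrACA.
by rewrite ler_wpM2r ?mulr_ge0 ?negbin_ge0.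
Qed.

Lemma asy_pos_pow k : asy k k`!%:R (pos_pow R k).
Proof.
(* The indicator of [n > 0] differs from the constant [negbin 1] only at 0, where [negbin 0] is
   1. *)
have H0 : asy 0 1 (pos_pow R 0).
  exists 1 => -[|n]; rewrite /pos_pow /negbin ?bin0 !mul1r ?expr0 ?mul1r ?mulr1.
    by rewrite sub0r normrN normr1.
  by rewrite addn1 binn subrr normr0 ler0n.
have := asy_mulXn k H0; rewrite add0n fact0 invr1 mulr1 mul1r.
by move/asy_ext; apply => n; rewrite /pos_pow expr0 mulr1 mulrC.
Qed.

End ConvolutionAsymptotics.

(** * From coefficient bounds to limits *)

Section Limits.
Context {R : realType}.
Implicit Types (f g : nat -> R) (p n : nat).
Local Open Scope classical_set_scope.

Lemma cvg_invn : (n%:R^-1 : R) @[n --> \oo] --> (0 : R).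
Proof. by rewrite -cvg_shiftS; exact: cvg_harmonic. Qed.

Lemma cvg_shift_ratio j : ((n + j)%:R / n%:R : R) @[n --> \oo] --> (1 : R).
Proof.
have H : (1 + j%:R * n%:R^-1 : R) @[n --> \oo] --> (1 + j%:R * 0 : R).
  by apply: cvgD; [exact: cvg_cst | apply: cvgMl_tmp; exact: cvg_invn].
rewrite mulr0 addr0 in H; apply: cvg_trans H; apply: near_eq_cvg.
near=> n; have n_gt0 : (0 < n)%N by near: n; exact: nbhs_infty_gt.
by rewrite natrD mulrDl divff // pnatr_eq0 -lt0n.
Unshelve. all: by end_near. Qed.

Lemma cvg_expr f (a : R) p :
  f @ \oo --> a -> f n ^+ p @[n --> \oo] --> a ^+ p.
Proof.
move=> fa; elim: p => [|p IHp]; first exact: cvg_cst.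
rewrite exprS (_ : (fun n => _) = (f \* (fun n => f n ^+ p))); first exact: cvgM.
by apply/funext => n; rewrite exprS.
Qed.

Lemma cvg_negbin p :
  (negbin p.+1 n / n%:R ^+ p : R) @[n --> \oo] --> (p`!%:R^-1 : R).
Proof.
elim: p => [|p IHp].
  rewrite (_ : (fun n => _) = cst 1) ?invr1; first exact: cvg_cst.
  by apply/funext => n; rewrite /negbin addn1 binn divr1.
have -> : (p.+1`!%:R^-1 : R) = p`!%:R^-1 * 1 * p.+1%:R^-1.
  by rewrite factS natrM invfM mulrC mulr1.
have := cvgMr_tmp (b := p.+1%:R^-1) (cvgM IHp (cvg_shift_ratio p.+1)).
move=> lim; apply: (cvg_trans _ (lim _ _)); apply: near_eq_cvg; apply: nearW => n /=.
have -> : negbin p.+2 n = negbin p.+1 n * (n + p.+1)%:R / p.+1%:R :> R.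
  apply: (canRL (mulfK _)); first by rewrite pnatr_eq0.
  have := mulr_negbin (R := R) p.+1 n; rewrite natrD; lra.
by rewrite exprS invfM; ring.
Qed.

Lemma asy_cvg p c f : asy p c f ->
  f n / n%:R ^+ p @[n --> \oo] --> (c / p`!%:R : R).
Proof.
move=> [K fK]; have K_ge0 : 0 <= K.
  by have := le_trans (normr_ge0 _) (fK 0%N); rewrite negbin_n0 mulr1.
have small : (f n - c * negbin p.+1 n) / n%:R ^+ p @[n --> \oo] --> (0 : R).
  (* For [n > 0], [mulr_negbin] gives [negbin p n <= p * negbin p.+1 n / n], so the normalised error
     tends to 0. *)
  have bound0 : K * p%:R * (negbin p.+1 n / n%:R ^+ p * n%:R^-1)
      @[n --> \oo] --> (K * p%:R * (p`!%:R^-1 * 0) : R).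
    by apply: cvgMl_tmp; apply: cvgM; [exact: cvg_negbin | exact: cvg_invn].
  rewrite !mulr0 in bound0; apply: norm_cvg0.
  apply: (squeeze_cvgr _ (cvg_cst 0) bound0); near=> n.
  have n_gt0 : (0 < n)%N by near: n; exact: nbhs_infty_gt.
  rewrite normr_ge0 /= normrM [`|_^-1|]ger0_norm ?invr_ge0 ?exprn_ge0 //.
  rewrite [X in _ <= _ * X]mulrAC [leRHS]mulrA ler_wpM2r ?invr_ge0 ?exprn_ge0 //.
  apply: le_trans (fK n) _; rewrite -!mulrA ler_wpM2l //.
  rewrite mulrA ler_pdivlMr ?ltr0n // mulrC mulr_negbin ler_wpM2l //.
  by rewrite gerBl negbin_ge0.
have := cvgD small (cvgMl_tmp (a := c) (@cvg_negbin p)).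
rewrite add0r => lim; apply: (cvg_trans _ (lim _ _)); apply: near_eq_cvg; apply: nearW => n /=.
by rewrite addrfctE mulrBl -mulrA subrK.
Unshelve. all: by end_near. Qed.

(** The convolution of [sum_bigrass] is taken at [n + 2] but normalised by a power of [n];
    [((n + 2) / n)^p] tends to 1. *)
Lemma asy_cvg_shift p c f : asy p c f ->
  f n.+2 / n%:R ^+ p @[n --> \oo] --> (c / p`!%:R : R).
Proof.
move=> /asy_cvg; rewrite -(cvg_shiftn 2) => lim_f.
have {}lim_f : f (n + 2)%N / (n + 2)%:R ^+ p @[n --> \oo] --> (c / p`!%:R : R) by [].
have := cvgM lim_f (cvg_expr (p := p) (cvg_shift_ratio 2)).
rewrite expr1n mulr1 => lim; apply: (cvg_trans _ (lim _)); apply: near_eq_cvg; near=> n.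
have n_gt0 : (0 < n)%N by near: n; exact: nbhs_infty_gt.
by rewrite /= addn2 expr_div_n mulrA divfK // expf_neq0 // pnatr_eq0.
Unshelve. all: by end_near. Qed.

End Limits.

(** * Leading coefficients and the final constant *)

Definition moment_coef (R : realFieldType) (k : nat) : R :=
  2^-1 ^+ k * (k`!%:R * k`!%:R * (3 * k + 1)`!%:R / (2 * k + 1)`!%:R).

(** The convolution of two [pos_pow] contributes [k!^2] at order [2k + 1]; the factor [s^k] raises
    the order to [3k + 1] and contributes [(3k + 1)! / (2k + 1)!]. *)
Lemma asy_moment (R : realFieldType) k :
  asy (3 * k + 1)%N (moment_coef R k) (moment R k).
Proof.
have := asyZ (2^-1 ^+ k : R) (asy_mulXn k (asy_conv (asy_pos_pow k) (asy_pos_pow k))).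
have -> : ((k + k).+1 + k = 3 * k + 1)%N by lia.
have -> : ((k + k).+1 = 2 * k + 1)%N by lia.
move/asy_ext; apply => s.
by rewrite /moment exprMn mulrA [X in X * _]mulrC.
Qed.

Lemma asy_conv_moment (R : realFieldType) k l :
  asy (3 * (k + l)).+3 (moment_coef R k * moment_coef R l)
    (conv (moment R k) (moment R l)).
Proof.
have := asy_conv (asy_moment R k) (asy_moment R l).
by have -> : (3 * k + 1 + (3 * l + 1)).+1 = (3 * (k + l)).+3 by lia.
Qed.

(** Converts the [(2k + 1)! / k!^2] of [moment_coef] into the central binomial factors of the target
    constant. *)
Lemma factorial_central_bin (R : numFieldType) k :
  (2 * k + 1)%:R * 'C(2 * k, k)%:R * (k`!%:R * k`!%:R) = (2 * k + 1)`!%:R :> R.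
Proof.
have := @bin_fact (2 * k) k; rewrite (_ : 2 * k - k = k)%N; last lia.
move=> /(_ ltac:(lia)) binE.
by rewrite -!natrM -mulnA binE addn1 factS.
Qed.

Theorem theorem4p2 (R : realType) (k l : nat) :
  asymp_equiv
    (fun n : nat =>
       uniform_expectation (bigrass n)
         (fun w => (alpha w)%:R ^+ k * (beta w)%:R ^+ l : R))
    (fun n : nat =>
       n%:R ^+ (3 * (k + l)) /
       (2 ^ ((k + l)%:Z - 1)
        * (k + l + 1)%:R
        * 'C(3 * (k + l) + 2, 3 * k + 1)%:R
        * (2 * k + 1)%:R * 'C(2 * k, k)%:R
        * (2 * l + 1)%:R * 'C(2 * l, l)%:R)).
Proof.
pose C : R := 2 ^ ((k + l)%:Z - 1) * (k + l + 1)%:R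
  * 'C(3 * (k + l) + 2, 3 * k + 1)%:R * (2 * k + 1)%:R * 'C(2 * k, k)%:R
  * (2 * l + 1)%:R * 'C(2 * l, l)%:R.
rewrite /asymp_equiv -/C.
have fact_neq0 m : m`!%:R != 0 :> R by rewrite pnatr_eq0 -lt0n fact_gt0.
have num := asy_cvg_shift (asy_conv_moment R k l).
(* The number of bigrassmannian permutations is the case of zero exponents, asymptotic to
   [n^3 / 3!]. *)
have den := asy_cvg_shift (asy_conv_moment R 0 0).
have coef0 : moment_coef R 0 = 1.
  by rewrite /moment_coef !mul1r !muln0 !add0n invr1.
rewrite coef0 mul1r addn0 muln0 /= in den.
have limE : moment_coef R k * moment_coef R l / (3 * (k + l)).+3`!%:R /
    (1 / 3`!%:R) * C = 1.
  have bink := factorial_central_bin R k.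
  have binl := factorial_central_bin R l.
  have binkl : 'C(3 * (k + l) + 2, 3 * k + 1)%:R *
      ((3 * k + 1)`!%:R * (3 * l + 1)`!%:R) = (3 * (k + l) + 2)`!%:R :> R.
    have := @bin_fact (3 * (k + l) + 2) (3 * k + 1).
    rewrite (_ : _ - _ = 3 * l + 1)%N; last lia.
    by move=> /(_ ltac:(lia)) <-; rewrite !natrM.
  have factP : (3 * (k + l)).+3`!%:R =
      3 * (k + l + 1)%:R * (3 * (k + l) + 2)`!%:R :> R.
    rewrite factS natrM addn2; congr (_ * _).
    by rewrite -natrM; congr _%:R; lia.
  (* The exponent is an integer, equal to -1 at [k = l = 0]. *)
  have pow2 : 2 ^ ((k + l)%:Z - 1) = 2 ^+ k * 2 ^+ l / 2 :> R.
    by rewrite expfzDr ?pnatr_eq0 // -exprD.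
  rewrite /moment_coef factP -binkl -bink -binl /C pow2 !exprVn.
  have bin_neq0 m p : (p <= m)%N -> 'C(m, p)%:R != 0 :> R.
    by move=> le_pm; rewrite pnatr_eq0 -lt0n bin_gt0.
  have odd_neq0 m : (m + 1)%:R != 0 :> R by rewrite addn1 pnatr_eq0.
  have cancel_all (p q fk fl f3k f3l ck cl c dk dl m : R) :
      p != 0 -> q != 0 -> fk != 0 -> fl != 0 -> f3k != 0 -> f3l != 0 ->
      ck != 0 -> cl != 0 -> c != 0 -> dk != 0 -> dl != 0 -> m != 0 ->
      p^-1 * (fk * fk * f3k / (dk * ck * (fk * fk))) *
      (q^-1 * (fl * fl * f3l / (dl * cl * (fl * fl)))) /
      (3 * m * (c * (f3k * f3l))) / (1 / 6) *
      (p * q / 2 * m * c * dk * ck * dl * cl) = 1.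
    by move=> *; field; do !(apply/andP; split).
  by apply: cancel_all; rewrite ?expf_neq0 ?fact_neq0 ?odd_neq0 ?bin_neq0 //; lia.
have lim : (conv (moment R k) (moment R l) n.+2 / n%:R ^+ (3 * (k + l)).+3 /
    (conv (moment R 0) (moment R 0) n.+2 / n%:R ^+ 3) * C @[n --> \oo] -->
    (moment_coef R k * moment_coef R l / (3 * (k + l)).+3`!%:R /
    (1 / 3`!%:R) * C : R))%classic.
  apply: cvgMr_tmp; apply: cvgM => //; apply: cvgV => //.
rewrite limE in lim; apply: (cvg_trans _ lim); apply: near_eq_cvg; near=> n.
have n_gt0 : (0 < n)%N by near: n; exact: nbhs_infty_gt.
have n_neq0 : n%:R != 0 :> R by rewrite pnatr_eq0 -lt0n.
rewrite /uniform_expectation sum_bigrass.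
have -> : #|bigrass n|%:R = conv (moment R 0) (moment R 0) n.+2.
  rewrite -sum_bigrass -sum1_card natr_sum; apply: eq_bigr => w _.
  by rewrite !expr0 mulr1.
rewrite -[(3 * (k + l)).+3]addn3 exprD !invfM !invrK.
(* The three extra powers of [n] normalising the numerator cancel those of the count once
   [n > 0]. *)
have cancel_cube (s t x c u : R) : u != 0 ->
    s * (x * (u^-1 * (u^-1 / u))) * (t * (u * (u * u))) * c = s * t * (x * c).
  by move=> u_neq0; field.
exact: cancel_cube.
Unshelve. all: by end_near. Qed.
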